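(* Let $\mathbb{K}=\mathbb{R}$ or $\mathbb{C}$, let $\mathcal{U}\subset\mathbb{K}^n$ be a connected open subset, and let $X_1,X_2,\dots,X_p$ be linear vector fields on $\mathcal{U}$, pairwise distinct and not identically zero. If they satisfy the barycentric property, then they are nilpotent. In particular, the flows $\exp(tX_k)$ are polynomial in $t$.
   Context: A linear vector field is a vector field of the form $X(x)=Ax$ with $A$ an $n\times n$ matrix over $\mathbb{K}$; it is nilpotent if $A$ is nilpotent. $\exp(tX)$ denotes the flow of $X$. Vector fields $X_1,\dots,X_p$ on $\mathcal{U}$ satisfy the barycentric property if $\sum_{k=1}^p X_k(\exp(tX_k)(x))=0$ for all $x\in\mathcal{U}$ and all $t\in\mathbb{K}$ small; equivalently $\sum_{k=1}^p\exp(tX_k)(x)=p\,x$. *)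

(* Defs.v *)
From HB Require Import structures.
From mathcomp Require Import all_boot all_order all_algebra.
From mathcomp Require Import complex.
From mathcomp Require Import all_classical all_reals all_analysis.
Set Implicit Arguments.
Unset Strict Implicit.
Unset Printing Implicit Defensive.
Import Order.TTheory GRing.Theory Num.Theory.
Import numFieldNormedType.Exports.
Local Open Scope classical_set_scope.
Local Open Scope ring_scope.

Definition linear_field (K : numFieldType) (n : nat) (U : set 'cV[K]_n)
    (A : 'M[K]_n) (X : 'cV[K]_n -> 'cV[K]_n) : Prop :=
  forall x, U x -> X x = A *m x.

Definition nilpotent_mx (K : numFieldType) (n : nat) (A : 'M[K]_n) : Prop :=
  exists m : nat, A ^+ m = 0.

(* [phi t x] stands for exp(tX)(x).  Only starting points [x] in [U] and times
   [t] in [D x] matter, the values of [X] off [U] and of [phi] elsewhere being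
   arbitrary.  The derivative in [t] is taken over K: it is the complex
   (holomorphic) derivative when K is the field of complex numbers. *)
Definition local_flow (K : numFieldType) (n : nat) (U : set 'cV[K]_n)
    (X : 'cV[K]_n -> 'cV[K]_n) (D : 'cV[K]_n -> set K)
    (phi : K -> 'cV[K]_n -> 'cV[K]_n) : Prop :=
  forall x, U x ->
    [/\ open (D x), connected (D x), D x 0, phi 0 x = x &
      forall t : K, D x t ->
        U (phi t x) /\ is_derive (t : K^o) 1 (phi^~ x) (X (phi t x))].

(* How small [t] has to be may depend on [x]. *)
Definition barycentric (K : numFieldType) (n p : nat) (U : set 'cV[K]_n)
    (X : 'I_p -> 'cV[K]_n -> 'cV[K]_n)
    (phi : 'I_p -> K -> 'cV[K]_n -> 'cV[K]_n) : Prop :=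
  forall x, U x -> \forall t \near (0 : K), \sum_(k < p) X k (phi k t x) = 0.

Definition polynomial_in_time (K : numFieldType) (n : nat) (U : set 'cV[K]_n)
    (D : 'cV[K]_n -> set K) (phi : K -> 'cV[K]_n -> 'cV[K]_n) : Prop :=
  exists (d : nat) (c : 'I_d -> 'cV[K]_n -> 'cV[K]_n),
    forall x, U x -> forall t, D x t ->
      phi t x = \sum_(j < d) t ^+ j *: c j x.

(* Main.v *)
(* Differentiating the barycentric identity repeatedly at t = 0 gives
   sum_k A_k^m = 0 for all m >= 1, hence sum_k tr (q(A_k)) = 0 for every
   polynomial q without constant term.  Write X * prod_k char_poly(A_k) as
   X^a g with g(0) <> 0, choose a Bezout relation u X^a + v g = 1 and take
   q = u X^a: each q(A_k) is the projection killing the generalized 0-eigenspace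
   of A_k and fixing the other ones.  The trace of a projection is its rank, so
   in characteristic zero all these ranks vanish, whence q(A_k) = 0 and
   A_k^a = 0.  Once A is nilpotent, a downward induction on j shows that
   A^j phi_t(x) is polynomial in t: its derivative A^(j+1) phi_t(x) is, and a
   function with zero derivative on a connected open set of K is constant. *)
Require Import Defs.
From HB Require Import structures.
From mathcomp Require Import all_boot all_order all_algebra.
From mathcomp Require Import complex.
From mathcomp Require Import all_classical all_reals all_analysis.
From mathcomp Require Import ring.
Set Implicit Arguments.
Unset Strict Implicit.
Unset Printing Implicit Defensive.
Import Order.TTheory GRing.Theory Num.Theory.
Import numFieldNormedType.Exports.
Local Open Scope classical_set_scope.
Local Open Scope ring_scope.

(** * Linear algebra: vanishing power traces and nilpotency *)

(** In the full-rank factorization E = C R, cancelling C on the left and R on the right of E E = E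
    leaves R C = 1, and tr (C R) = tr (R C). *)
Lemma mxtrace_idempotent (F : fieldType) (n : nat) (E : 'M[F]_n) :
  E *m E = E -> \tr E = (\rank E)%:R.
Proof.
move=> EE; have RC : row_base E *m col_base E = 1%:M.
  apply: (row_free_inj (row_base_free E)).
  apply: (@row_full_inj _ _ _ _ (col_base E)); first exact: col_base_full.
  rewrite mul1mx -(mulmxA (row_base E)) mulmx_base.
  by rewrite (mulmxA (col_base E)) mulmx_base.
by rewrite -{1}(mulmx_base E) mxtrace_mulC RC mxtrace1.
Qed.

Lemma nilpotent_of_mxtrace_sum (K : numFieldType) (n p : nat)
    (A : 'I_p -> 'M[K]_n) :
  (forall m, \sum_k \tr (A k ^+ m.+1) = 0) -> forall k, nilpotent_mx (A k).
Proof.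
case: n A => [|n] A trA k; first by exists 0%N; exact: thinmx0.
pose chi := 'X * \prod_k char_poly (A k).
have chi_neq0 : chi != 0.
  rewrite monic_neq0// monicMl ?monicX// monic_prod// => i _.
  exact: char_poly_monic.
have chiA i : horner_mx (A i) chi = 0.
  rewrite /chi (bigD1 i)//= !rmorphM/= Cayley_Hamilton mul0r mulr0//.
have [a [g g0 chiE]] := multiplicity_XsubC chi 0.
rewrite subr0 chi_neq0 /= in g0 chiE.
(* The explicit factor ['X] in [chi] forces this even when every A_k is invertible; it keeps [q]
   free of a constant term. *)
have a_gt0 : (0 < a)%N.
  rewrite lt0n; apply/eqP => a0; move: g0.
  by rewrite -[g]mulr1 -(expr0 'X) -a0 -chiE rootE hornerM hornerX mul0r eqxx.
have /Bezout_eq1_coprimepP[[u v]/= uv1] : coprimep ('X ^+ a) g.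
  by rewrite coprimep_expl// -['X]subr0 coprimep_sym coprimep_XsubC.
pose q := u * 'X ^+ a.
have qE : q - 1 = - (v * g) by rewrite -uv1 opprD addrA subrr add0r.
(* [q] is idempotent modulo [chi], since q (q - 1) = - u v chi. *)
have qA i : horner_mx (A i) q *m horner_mx (A i) q = horner_mx (A i) q.
  apply/eqP; rewrite -subr_eq0 mulmxE -rmorphM -rmorphB/=.
  have -> : q * q - q = - (u * v) * chi.
    by rewrite -{3}[q]mulr1 -mulrBr qE chiE /q; ring.
  by rewrite rmorphM/= chiA mulr0.
have trq : \sum_i \tr (horner_mx (A i) q) = 0.
  (* Expanding [u] leaves only powers with exponent j + a >= 1, whose trace sums vanish. *)
  rewrite /q -(coefK u) poly_def mulr_suml.
  under eq_bigr do rewrite !raddf_sum/=.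
  rewrite exchange_big big1// => j _.
  rewrite (eq_bigr (fun i => u`_j * \tr (A i ^+ (j + a.-1).+1))) => [|i _].
    by rewrite -mulr_sumr trA mulr0.
  by rewrite -scalerAl -exprD -addnS prednK// !linearZ/= rmorphXn/= horner_mx_X.
have rk0 : \rank (horner_mx (A k) q) = 0%N.
  move: trq; under eq_bigr do rewrite mxtrace_idempotent//.
  rewrite -natr_sum => /eqP; rewrite pnatr_eq0 sum_nat_eq0.
  by move=> /forallP/(_ k)/eqP.
have q0 : horner_mx (A k) q = 0 by apply/eqP; rewrite -mxrank_eq0 rk0.
(* Multiply the Bezout relation by X^a: one term contains [q], the other is a multiple of [chi]. *)
exists a; transitivity (horner_mx (A k) ('X ^+ a * (q + v * g))).
  by rewrite uv1 mulr1 rmorphXn/= horner_mx_X.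
rewrite mulrDr rmorphD rmorphM/= q0 mulr0 add0r.
have -> : 'X ^+ a * (v * g) = v * chi by rewrite chiE; ring.
by rewrite rmorphM/= chiA mulr0.
Qed.

(** * Derivatives of scalar functions along a curve *)

(** Pairing with a fixed row is linear and continuous, so it passes through the difference quotient.
    This reduces vector curves to scalar functions. *)
Lemma is_derive_row_mul (K : numFieldType) (V : normedModType K) (n : nat)
    (u : 'rV[K]_n) (y : V -> 'cV[K]_n) (t v : V) (dy : 'cV[K]_n) :
  is_derive t v y dy ->
  is_derive t v (fun s => (u *m y s) 0 0 : K^o) ((u *m dy) 0 0).
Proof.
move=> [yt yE].
have u_cont : continuous (fun w : 'cV[K]_n => (u *m w) 0 0 : K^o).
  rewrite [X in continuous X](_ : _ =
    fun w : 'cV[K]_n => \sum_j (u 0 j * w j 0)).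
    apply: continuous_big => [|j _ w]; first exact: add_continuous.
    by apply: continuousM; [exact: cst_continuous|exact: coord_continuous].
  by apply/funext => z; rewrite mxE.
pose y_quot h := h^-1 *: ((y \o shift t) (h *: v) - y t).
suff quot_cvg : (fun h => (u *m y_quot h) 0 0 : K^o) @ 0^' --> (u *m dy) 0 0.
  rewrite (_ : (fun h => _) = fun h =>
    h^-1 *: (((fun s => (u *m y s) 0 0 : K^o) \o shift t) (h *: v)
             - (u *m y t) 0 0)) in quot_cvg.
    by split; [apply/cvg_ex; exists ((u *m dy) 0 0)|exact: cvg_lim].
  by apply/funext => h /=; rewrite -scalemxAr mulmxBr !mxE.
by apply: (cvg_comp y_quot _ _ (u_cont dy)); rewrite -yE; exact: yt.
Qed.

Lemma is_derive_horner (K : numFieldType) (q : {poly K}) (t : K^o) :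
  is_derive t 1 (fun s : K^o => q.[s] : K^o) q^`().[t].
Proof.
elim/poly_ind: q => [|q c IH].
  rewrite deriv0 hornerC (_ : (fun s => _) = cst 0); first exact: is_derive_cst.
  by apply/funext => s; rewrite hornerC.
rewrite (_ : (fun s => _) = (fun s : K^o => q.[s] : K^o) * id + cst c);
  last first.
  by apply/funext => s; rewrite !hornerE.
apply: is_derive_eq; rewrite derivD derivM derivX derivC !hornerE.
by rewrite /GRing.scale/= mulr1 mulrC addrC.
Qed.

(** Near 0, each t has a whole neighbourhood on which f vanishes. Concluding near 0, and not just at
    0, allows iteration. *)
Lemma near0_derive_eq0 (K : numFieldType) (W : normedModType K)
    (f df : K^o -> W) :
  (\forall t \near (0 : K^o), f t = 0) ->
  (\forall t \near (0 : K^o), is_derive (t : K^o) 1 f (df t)) ->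
  \forall t \near (0 : K^o), df t = 0.
Proof.
move=> /near_join f0 fdf; near=> t.
have f0t : \forall s \near t, f s = 0 by near: t.
have [_ <-] : is_derive (t : K^o) 1 f (df t) by near: t.
by rewrite (near_eq_derive (g := cst 0)) ?derive_cst.
Unshelve. all: by end_near. Qed.

(** * Vanishing derivatives and constancy *)

(* Treats the real part, the imaginary part and the identity of R uniformly:
   [re] is a real coordinate of K and [iota] embeds the reals in K. *)
Section RealCoordinate.
Variables (R : realType) (K : numFieldType).
Variables (iota : {rmorphism R -> K}) (re : {additive K -> R}).
Hypothesis iota_cont : continuous (iota : R -> K).
Hypothesis iota_le1 : forall s, 0 <= s <= 1 -> `|iota s| <= 1.
Hypothesis re_cont : continuous (re : K -> R).
Hypothesis re_scale : forall r z, re (iota r * z) = r * re z.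

Lemma is_derive0_line (f : K^o -> K^o) (a w : K) (s : R) :
  is_derive (a + iota s * w : K^o) 1 f 0 ->
  is_derive s 1 (fun r => re (f (a + iota r * w))) 0.
Proof.
move=> [/= df f0].
(* For w = 0 the path is constant. Otherwise the increments [iota h * w] avoid 0, and the real
   quotient at h is [re] of w times the K-quotient at [iota h * w]. *)
have [->|w0] := eqVneq w 0.
  rewrite (_ : (fun r => _) = cst (re (f a))); first exact: is_derive_cst.
  by apply/funext => r; rewrite mulr0 addr0.
set t := a + iota s * w in df f0 *.
have line_cont : continuous (fun h : R => iota h * w).
  by move=> h; apply: continuousM; [exact: iota_cont|exact: cst_continuous].
have line0 : (fun h : R => iota h * w) @ 0^' --> (0 : K)^'.
  move=> P P0.
  have : \forall h \near 0^', iota h * w != 0 -> P (iota h * w).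
    have := line_cont 0; rewrite /continuous_at rmorph0 mul0r => lc.
    by apply: nbhs_dnbhs; exact: lc P0.
  apply: filter_app; near=> h; apply; rewrite mulf_neq0// fmorph_eq0.
  by near: h; exact: nbhs_dnbhs_neq.
have cv : (fun h : K => re (w * (h^-1 * (f (h + t) - f t)))) @ 0^'
    --> re (w * 0).
  apply: continuous_cvg; first exact: re_cont.
  apply: cvgM; first exact: cvg_cst.
  have -> : (fun h : K => h^-1 * (f (h + t) - f t)) = fun h : K =>
    h^-1 *: ((f \o shift t) (h *: (1 : K^o)) - f t).
    by apply/funext => h /=; rewrite [h *: _]mulr1.
  by rewrite -[X in _ --> X]f0; exact: df.
rewrite mulr0 raddf0 in cv.
have quot_cvg : (fun h => h^-1 *:
    (((fun r => re (f (a + iota r * w))) \o shift s) (h *: 1) - re (f t)))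
    @ 0^' --> (0 : R).
  have := cvg_comp _ _ line0 cv; apply: cvg_trans; apply: near_eq_cvg.
  near=> h => /=.
  have h0 : h != 0 by near: h; exact: nbhs_dnbhs_neq.
  rewrite [h *: 1]mulr1 rmorphD mulrDl addrCA -/t -raddfB.
  rewrite -[_ *: _]/(_ * _) -re_scale fmorphV; congr (re _).
  by rewrite invfM mulrA (mulrCA w) divff// mulr1.
by split; [apply/cvg_ex; exists 0|exact: cvg_lim].
Unshelve. all: by end_near. Qed.

(** The segment from a to b stays in the ball because [iota] has norm at most 1 on [0, 1]; the real
    mean value theorem applies along it. *)
Lemma locally_constant_coord (f : K^o -> K^o) (a : K) :
  (\forall t \near a, is_derive (t : K^o) 1 f 0) ->
  \forall t \near a, re (f t) = re (f a).
Proof.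
move=> /nbhs_ballP[e /= e0 ef]; apply/nbhs_ballP; exists e => //= b ab.
pose g (s : R) := re (f (a + iota s * (b - a))).
have dg (s : R) : 0 <= s <= 1 -> is_derive s 1 g 0.
  move=> s01; apply: is_derive0_line; apply: ef => /=.
  rewrite -ball_normE/= opprD addNKr normrN normrM.
  move: ab; rewrite -ball_normE/= distrC; apply: le_lt_trans.
  by rewrite ler_piMl// iota_le1.
have [||_ _] := @MVT_segment R g (fun=> 0) 0 1 ler01.
- by move=> s; rewrite in_itv/= => /andP[s0 s1]; apply: dg; rewrite !ltW.
- by apply: derivable_within_continuous => s; rewrite in_itv/= => /dg [].
move=> /eqP; rewrite mul0r subr_eq0 /g rmorph0 rmorph1 mul0r mul1r addr0 subrKC.
by move=> /eqP.
Qed.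

End RealCoordinate.

Lemma real_complex_continuous (R : realType) :
  continuous (real_complex R : R -> (R[i] : numFieldType)).
Proof.
move=> x P /nbhs_ballP[e /= e0 eP]; apply/nbhs_ballP.
(* The radius is an element of [R[i]]; being positive, it is real. *)
have eE : e = ((complex.Re e)%:C)%C by rewrite RRe_real// gtr0_real.
exists (complex.Re e) => [|y] /=; first by rewrite -ltcR -eE.
rewrite -ball_normE/= -ltcR -eE => xy; apply: eP; rewrite -ball_normE/=.
by rewrite -rmorphB/= normc_def/= expr0n/= addr0 sqrtr_sqr.
Qed.

Lemma Re_continuous (R : realType) :
  continuous (@complex.Re R : (R[i] : numFieldType) -> R).
Proof.
move=> x P /nbhs_ballP[e /= e0 eP]; apply/nbhs_ballP.
exists (e%:C)%C => [|y] /=; first by rewrite ltcR.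
rewrite /ball/= => xy; apply: eP; rewrite -ball_normE/= -ltcR.
by apply: le_lt_trans xy; rewrite -raddfB; exact: normc_ge_Re.
Qed.

Lemma locally_constant_of_derive0 (R : realType) (K : numFieldType)
    (hK : K = (R : numFieldType) \/ K = (R[i] : numFieldType))
    (f : K^o -> K^o) (a : K) :
  (\forall t \near a, is_derive (t : K^o) 1 f 0) ->
  \forall t \near a, f t = f a.
Proof.
case: hK => KE; subst K => df.
  have idc : continuous (idfun : R -> R) by move=> x; exact: cvg_id.
  apply: (locally_constant_coord (re := idfun) idc _ idc _ df) => // s.
  by move=> /andP[s0 s1]; rewrite ger0_norm.
have coord (g : R[i]^o -> R[i]^o) :
    (\forall t \near a, is_derive (t : R[i]^o) 1 g 0) ->
    \forall t \near a, complex.Re (g t) = complex.Re (g a).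
  apply: (@locally_constant_coord R R[i] (real_complex R) (@complex.Re R)).
  - exact: real_complex_continuous.
  - move=> s /andP[s0 s1]; rewrite normc_def/= expr0n/= addr0 sqrtr_sqr.
    by rewrite -[1]/((1%:C)%C) lecR ger0_norm.
  - exact: Re_continuous.
  - by move=> r [x y]; simpc.
(* The imaginary part of f is minus the real part of i f, whose derivative also vanishes. *)
have Im_f := coord ('i%C \*: f).
near=> t.
apply/eqP; rewrite eq_complex; apply/andP; split; apply/eqP.
  by near: t; exact: coord.
have : complex.Re ('i%C * f t) = complex.Re ('i%C * f a).
  near: t; apply: Im_f; apply: filterS df => t ft.
  rewrite -[X in is_derive _ _ _ X](scaler0 _ ('i%C : R[i])).
  exact: is_deriveZ.
by rewrite ![_ * f _]mulrC !ReiNIm => /oppr_inj.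
Unshelve. all: by end_near. Qed.

(** The level set of f through s is relatively open and relatively closed in D, both witnessed by
    interiors taken in T. *)
Lemma connected_locally_constant (T : topologicalType) (S : Type) (D : set T)
    (f : T -> S) :
  connected D -> (forall t, D t -> \forall u \near t, f u = f t) ->
  {in D &, forall s t, f s = f t}.
Proof.
move=> Dconn flc s t; rewrite !inE => Ds Dt.
suff /seteqP[_ /(_ t Dt) []//] : D `&` [set u | f s = f u] = D.
apply: Dconn.
- by exists s.
- exists (interior [set u | f s = f u]); first exact: open_interior.
  apply/seteqP; split=> u [Du fu]; split=> //; last exact: interior_subset fu.
  by apply: filterS (flc u Du) => v /= ->.
- exists (~` interior [set u | f s <> f u]).
    by rewrite closedC; exact: open_interior.
  apply/seteqP; split=> u [Du fu]; split=> //=.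
    by move=> /interior_subset; apply.
  apply: contrapT => fsu; apply: fu.
  by apply: filterS (flc u Du) => v /= ->.
Qed.

(** * From the barycentric property to power sums *)

(** From x0 in U one can move by a small t e_j with t nonzero and stay in U; subtracting the two
    equations gives t B e_j = 0. *)
Lemma mulmx_eq0_open (K : numFieldType) (m n : nat) (U : set 'cV[K]_n)
    (B : 'M[K]_(m, n)) :
  open U -> U !=set0 -> (forall x, U x -> B *m x = 0) -> B = 0.
Proof.
move=> U_open [x0 Ux0] BU.
suff colB j : B *m delta_mx j 0 = 0 :> 'cV_m.
  by apply/matrixP => i j; move/colP: (colB j) => /(_ i); rewrite -colE !mxE.
have line_cvg :
    (fun t : K^o => t *: (delta_mx j 0 : 'cV[K]_n) + x0) @ 0^' --> x0.
  rewrite -[X in _ --> X]add0r -(scale0r (delta_mx j 0)).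
  apply: cvgD; last exact: cvg_cst.
  by apply: cvgZr_tmp; exact: nbhs_dnbhs.
have [t [t0 Ut]] : exists t : K, t != 0 /\ U (t *: delta_mx j 0 + x0).
  apply: (@filter_ex _ (0 : K)^'); near=> t; split.
    by near: t; exact: nbhs_dnbhs_neq.
  by near: t; apply: line_cvg; exact: open_nbhs_nbhs.
move: (BU _ Ut); rewrite mulmxDr (BU _ Ux0) addr0 -scalemxAr => /eqP.
by rewrite scaler_eq0 (negPf t0) => /eqP.
Unshelve. all: by end_near. Qed.

(** Used for both conclusions: the flow stays in U, where X is A, so each derivative in t raises the
    exponent of A by one. *)
Lemma linear_local_flow_is_derive (K : numFieldType) (n : nat)
    (U : set 'cV[K]_n) (A : 'M[K]_n) (X : 'cV[K]_n -> 'cV[K]_n)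
    (D : 'cV[K]_n -> set K) (phi : K -> 'cV[K]_n -> 'cV[K]_n) :
  linear_field U A X -> local_flow U X D phi ->
  forall x, U x -> forall (u : 'rV[K]_n) j t, D x t ->
  is_derive (t : K^o) 1 (fun s : K^o => (u *m A ^+ j *m phi s x) 0 0 : K^o)
    ((u *m A ^+ j.+1 *m phi t x) 0 0).
Proof.
move=> XA flow x Ux u j t Dt; have [_ _ _ _ /(_ t Dt)[Ut dphi]] := flow x Ux.
apply: is_derive_eq; first exact: is_derive_row_mul dphi.
by rewrite XA// exprSr -mulmxE !mulmxA.
Qed.

Lemma barycentric_sum_powers (K : numFieldType) (n p : nat) (U : set 'cV[K]_n)
    (X : 'I_p -> 'cV[K]_n -> 'cV[K]_n) (A : 'I_p -> 'M[K]_n)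
    (D : 'I_p -> 'cV[K]_n -> set K)
    (phi : 'I_p -> K -> 'cV[K]_n -> 'cV[K]_n) :
  open U -> U !=set0 -> (forall k, linear_field U (A k) (X k)) ->
  (forall k, local_flow U (X k) (D k) (phi k)) -> barycentric U X phi ->
  forall m, \sum_k A k ^+ m.+1 = 0.
Proof.
move=> U_open U0 XA flow bary m; apply: (mulmx_eq0_open U_open U0) => x Ux.
have Dnear : \forall t \near (0 : K), forall k, D k x t.
  apply: (filter_forall (nbhs_filter (0 : K))) => k.
  have [Dop _ D0 _ _] := flow k x Ux; exact: open_nbhs_nbhs.
(* The base case is the barycentric identity itself, hence the shift to [j.+1]; each further power
   costs one differentiation. *)
have sum0 (u : 'rV[K]_n) j :
    \forall t \near (0 : K), \sum_k (u *m A k ^+ j.+1 *m phi k t x) 0 0 = 0.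
  elim: j => [|j IH].
    near=> t; transitivity ((u *m \sum_k X k (phi k t x)) 0 0); last first.
      by rewrite (_ : \sum_k _ = 0) ?mulmx0 ?mxE//; near: t; exact: bary.
    have Dt : forall k, D k x t by near: t.
    rewrite mulmx_sumr summxE; apply: eq_bigr => k _.
    have [_ _ _ _ /(_ t (Dt k))[Ut _]] := flow k x Ux.
    by rewrite XA// expr1 mulmxA.
  apply: (near0_derive_eq0 IH); near=> t.
  have Dt : forall k, D k x t by near: t.
  rewrite [X in is_derive _ _ X](_ : _ =
    \sum_k (fun s : K^o => (u *m A k ^+ j.+1 *m phi k s x) 0 0 : K^o)).
    apply: is_derive_sum => k.
    exact: linear_local_flow_is_derive (XA k) (flow k) x Ux u _ _ (Dt k).
  by apply/funext => s; rewrite fct_sumE.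
(* Evaluate at t = 0, where the flow is x, with [u] the i-th coordinate row. *)
apply/colP => i; rewrite mulmx_suml summxE [RHS]mxE.
rewrite -[RHS](nbhs_singleton (sum0 (delta_mx 0 i) m)); apply: eq_bigr => k _.
have [_ _ _ -> _] := flow k x Ux.
by rewrite -mulmxA -rowE [RHS]mxE.
Unshelve. all: by end_near. Qed.

(** * Polynomial flows of nilpotent fields *)

Lemma nilpotent_flow_polynomial (R : realType) (K : numFieldType)
    (hK : K = (R : numFieldType) \/ K = (R[i] : numFieldType))
    (n : nat) (U : set 'cV[K]_n) (A : 'M[K]_n) (X : 'cV[K]_n -> 'cV[K]_n)
    (D : 'cV[K]_n -> set K) (phi : K -> 'cV[K]_n -> 'cV[K]_n) :
  linear_field U A X -> local_flow U X D phi -> nilpotent_mx A ->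
  polynomial_in_time U D phi.
Proof.
(* The witnesses are the coefficients of exp(tA) x, truncated at an exponent that kills A. *)
move=> XA flow [m Am]; exists m, (fun j x => j`!%:R^-1 *: (A ^+ j *m x)).
move=> x Ux; have [D_open D_conn D0 phi0 _] := flow x Ux.
have Am_ge j : (m <= j)%N -> A ^+ j = 0.
  by move=> /subnKC <-; rewrite exprD Am mul0r.
pose c (u : 'rV[K]_n) j := (u *m A ^+ j *m x) 0 0.
have c_ge u j : (m <= j)%N -> c u j = 0.
  by move=> /Am_ge Aj; rewrite /c Aj mulmx0 mul0mx mxE.
(* The expected value of u A^j exp(tA) x as a polynomial in t. *)
pose P u j := \poly_(l < m) (c u (j + l)%N / l`!%:R).
have dP u j : (P u j)^`() = P u j.+1.
  apply/polyP => l; rewrite coef_deriv !coef_poly addnS addSn.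
  have fl : l.+1`!%:R^-1 *+ l.+1 = l`!%:R^-1 :> K.
    rewrite -[LHS]mulr_natr factS natrM invfM mulrAC.
    by rewrite mulVf ?mul1r// pnatr_eq0.
  case: ltnP => lm; first by rewrite (ltnW lm) -mulrnAr fl.
  (* Truncation at m is compatible with differentiation: the extra coefficient, at l = m - 1,
     involves A^(j + m) = 0. *)
  rewrite mul0rn; case: ifP => // _.
  by rewrite c_ge ?mul0r// (leq_trans lm)// -addnS leq_addl.
(* [i] measures the downward induction on j; at i = 0, j >= m and both sides vanish. *)
have flowE i j u t : (m <= i + j)%N -> D x t ->
    (u *m A ^+ j *m phi t x) 0 0 = (P u j).[t].
  elim: i j t => [|i IH] j t mij Dt.
    rewrite (Am_ge j)// mulmx0 mul0mx mxE horner_poly big1// => l _.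
    by rewrite c_ge ?mul0r// (leq_trans mij)// leq_addr.
  pose f (s : K^o) : K^o := (u *m A ^+ j *m phi s x) 0 0 - (P u j).[s].
  have df s : D x s -> is_derive (s : K^o) 1 f 0.
    move=> Ds; apply: is_derive_eq.
      apply: is_deriveB; last exact: is_derive_horner.
      exact: linear_local_flow_is_derive XA flow x Ux u _ _ Ds.
    by rewrite dP IH ?addnS// subrr.
  apply/eqP; rewrite -subr_eq0 -/(f t).
  rewrite (@connected_locally_constant _ _ _ f D_conn _ t 0) ?inE//.
    rewrite /f phi0 horner_coef0 coef_poly addn0 fact0 divr1 -/(c u j).
    (* If m = 0, [P u j] has no coefficients, but then [c u j] is 0 too. *)
    by case: ltnP => [_|m0]; rewrite ?subrr// c_ge ?subr0// (leq_trans m0).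
  move=> s Ds; apply: (locally_constant_of_derive0 hK).
  by apply: filterS df _; exact: open_nbhs_nbhs.
move=> t Dt; apply/colP => i.
have := flowE m 0%N (delta_mx 0 i) t; rewrite addn0 => /(_ (leqnn m) Dt).
rewrite expr0 mulmx1 -rowE mxE => ->.
rewrite horner_poly summxE; apply: eq_bigr => l _.
by rewrite /c -mulmxA -rowE !mxE mulrC (mulrC _ l`!%:R^-1).
Qed.

Theorem theorem4 (R : realType) (K : numFieldType)
  (hK : K = (R : numFieldType) \/ K = (R[i] : numFieldType))
  (n p : nat) (U : set 'cV[K]_n)
  (U_open : open U) (U_connected : connected U)
  (X : 'I_p -> 'cV[K]_n -> 'cV[K]_n) (A : 'I_p -> 'M[K]_n)
  (X_linear : forall k, linear_field U (A k) (X k))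
  (X_distinct : forall i j, i != j -> exists2 x, U x & X i x <> X j x)
  (X_nonzero : forall k, exists2 x, U x & X k x <> 0)
  (D : 'I_p -> 'cV[K]_n -> set K)
  (phi : 'I_p -> K -> 'cV[K]_n -> 'cV[K]_n)
  (phi_flow : forall k, local_flow U (X k) (D k) (phi k))
  (X_barycentric : barycentric U X phi) :
  (forall k, nilpotent_mx (A k)) /\
  (forall k, polynomial_in_time U (D k) (phi k)).
Proof.
have nilA k : nilpotent_mx (A k).
  (* The point where X_k does not vanish shows that U is inhabited. *)
  have U0 : U !=set0 by have [x Ux _] := X_nonzero k; exists x.
  apply: nilpotent_of_mxtrace_sum => m.
  have powers0 := barycentric_sum_powers U_open U0 X_linear phi_flow.
  by rewrite -raddf_sum powers0// raddf0.
split=> // k.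
exact (nilpotent_flow_polynomial hK (X_linear k) (phi_flow k) (nilA k)).
Qed.
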